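(* For every positive integer $m$, the Sylvester-type Hadamard matrix of order $4^m$ is twin balancedly splittable; that is, with $n=2^m$, its rows can be permuted so that it has the form $H=\begin{pmatrix}H_1\\H_2\\H_3\end{pmatrix}$ where $H$ is balancedly splittable with parameters $(n^2,n,n,0)$ with respect to $H_1$, and with parameters $(n^2,n(n-1)/2,n/2,-n/2)$ with respect to $H_2$ and with respect to $H_3$.
   Context: A Hadamard matrix of order $n$ is an $n\times n$ matrix $H$ with entries $\pm1$ satisfying $HH^\top=nI_n$. A Hadamard matrix $H$ of order $n$ is balancedly splittable with respect to an $\ell\times n$ submatrix $H_1$ if, after permuting rows, $H=\begin{pmatrix}H_1\\H_2\end{pmatrix}$ and $H_1^\top H_1=\ell I_n+aA+b(J_n-A-I_n)$ for some integers $a\ge b$ and some $(0,1)$-matrix $A$, where $J_n$ is the all-ones matrix; $(n,\ell,a,b)$ are called its parameters. Let $S_1=\begin{pmatrix}1&1\\1&-1\end{pmatrix}$ and $S_m=S_{m-1}\otimes S_1$ for $m\ge2$; $S_m$ is the Sylvester-type Hadamard matrix of order $2^m$. A balancedly splittable Hadamard matrix $H$ of order $n^2$ is called twin if $H=\begin{pmatrix}H_1\\H_2\\H_3\end{pmatrix}$ where $H$ is balancedly splittable with parameters $(n^2,n,n,0)$ with respect to $H_1$ and with parameters $(n^2,n(n-1)/2,n/2,-n/2)$ with respect to $H_2$ and $H_3$. *)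

(* Defs.v *)
From mathcomp Require Import all_boot all_order all_algebra all_fingroup.
From mathcomp Require Import mxtens.

Set Implicit Arguments.
Unset Strict Implicit.
Unset Printing Implicit Defensive.

Import GRing.Theory Num.Theory.
Local Open Scope ring_scope.

Definition hadamard (n : nat) (H : 'M[int]_n) : Prop :=
  (forall i j, H i j = 1 \/ H i j = -1) /\ H *m H^T = n%:R%:M.

Definition row_splits (n l : nat) (H : 'M[int]_n) (H1 : 'M[int]_(l, n)) : Prop :=
  exists (s : 'S_n) (r : nat) (e : (l + r)%N = n) (H2 : 'M[int]_(r, n)),
    row_perm s H = castmx (e, erefl n) (col_mx H1 H2).

Definition balancedly_splittable (n l : nat) (a b : int)
    (H : 'M[int]_n) (H1 : 'M[int]_(l, n)) : Prop :=
  [/\ hadamard H, row_splits H H1, b <= a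
    & exists A : 'M[int]_n,
        (forall i j, A i j = 0 \/ A i j = 1) /\
        H1^T *m H1 = l%:R%:M + a *: A + b *: (const_mx 1 - A - 1%:M)].

(* [H] has order [N = n ^ 2]; keeping [N] separate avoids transporting [H]
   along [2 ^ (2 * m) = (2 ^ m) ^ 2]. Since the parameters are integers, [n]
   has to be even, so that the truncated quotients below are exact. *)
Definition twin_balancedly_splittable (n N : nat) (H : 'M[int]_N) : Prop :=
  let k := (n * (n - 1) %/ 2)%N in
  let c := (n %/ 2)%N%:Z in
  [/\ N = (n ^ 2)%N, ~~ odd n
    & exists (H1 : 'M[int]_(n, N)) (H2 H3 : 'M[int]_(k, N))
             (e : (n + (k + k))%N = N),
      [/\ H = castmx (e, erefl N) (col_mx H1 (col_mx H2 H3)),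
          balancedly_splittable n%:Z 0 H H1,
          balancedly_splittable c (- c) H H2
        & balancedly_splittable c (- c) H H3]].

Definition sylvester1 : 'M[int]_2 :=
  \matrix_(i, j) (if (i == 1) && (j == 1) then -1 else 1).

(* Only [1 <= m] is meaningful; the value at [m = 0] is a placeholder. *)
Fixpoint sylvester (m : nat) : 'M[int]_(2 ^ m) :=
  match m with
  | 0 => 1%:M
  | m'.+1 =>
      match m' return 'M[int]_(2 ^ m') -> 'M[int]_(2 ^ m'.+1) with
      | 0 => fun=> sylvester1
      | m''.+1 => fun S =>
          castmx (esym (expnSr 2 m''.+1), esym (expnSr 2 m''.+1))
                 (S *t sylvester1)
      end (sylvester m')
  end.

(* Main.v *)
Require Import Defs.
From mathcomp Require Import all_boot all_order all_algebra all_fingroup.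
From mathcomp Require Import zify ring.

(* The Sylvester matrix of order [4 ^ m] is the character table of
   [F_2 ^ m x F_2 ^ m], so the Gram matrix of the rows in a set [D] is given by
   the character sums of [D]. Let [f (u, v) = u . v], a bent function. Take for
   [H_1] the rows in the subgroup [v = 0], whose character sums are [n] or [0];
   for [H_2] the rows with [f = 1], whose nontrivial character sums are [+-n/2];
   and for [H_3] the rows with [f = 0] and [v <> 0]. A nontrivial character sum
   of the last set is [+-n/2], from the zeros of [f], minus [n] on the
   annihilator of the subgroup; there the dual of [f] vanishes, so the sign is
   [+] and the result is [n/2 - n = -n/2]. All the sums factor over the [m]
   coordinates. *)

Set Implicit Arguments.
Unset Strict Implicit.
Unset Printing Implicit Defensive.

Import GRing.Theory Num.Theory.
Local Open Scope ring_scope.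

(** * Row selection by injections, and splittability from Gram entries *)

Definition split_fun (T : Type) (a b : nat) (f : 'I_a -> T) (g : 'I_b -> T)
    (i : 'I_(a + b)) : T :=
  match split i with inl j => f j | inr j => g j end.

Lemma split_funl T a b (f : 'I_a -> T) (g : 'I_b -> T) i :
  split_fun f g (lshift b i) = f i.
Proof.
by rewrite /split_fun; case: split_ordP => j /eqP; rewrite eq_shift // => /eqP->.
Qed.

Lemma split_funr T a b (f : 'I_a -> T) (g : 'I_b -> T) i :
  split_fun f g (rshift a i) = g i.
Proof.
by rewrite /split_fun; case: split_ordP => j /eqP; rewrite eq_shift // => /eqP->.
Qed.

Lemma split_fun_inj T a b (f : 'I_a -> T) (g : 'I_b -> T) :
  injective f -> injective g -> (forall i j, f i <> g j) ->
  injective (split_fun f g).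
Proof.
move=> injf injg fg i j; rewrite /split_fun.
case: (split_ordP i) => u ->; case: (split_ordP j) => v -> eq_uv.
- by rewrite (injf _ _ eq_uv).
- by case: (fg u v).
- by case: (fg v u).
- by rewrite (injg _ _ eq_uv).
Qed.

Lemma enum_inj_fun (T : finType) (D : {set T}) l : #|D| = l ->
  exists h : 'I_l -> T,
    [/\ injective h, forall i, h i \in D
      & forall F : T -> int, \sum_i F (h i) = \sum_(x in D) F x].
Proof.
move=> <-; exists (@enum_val _ (mem D)); split.
- exact: enum_val_inj.
- exact: enum_valP.
- by move=> F; apply/esym/big_enum_val.
Qed.

Lemma perm_of_inj_ord a n (e : a = n) (h : 'I_a -> 'I_n) : injective h ->
  exists s : 'S_n, forall i, s (cast_ord e i) = h i.
Proof.
case: n / e h => h injh; exists (perm injh) => i.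
by rewrite permE cast_ord_id.
Qed.

Lemma perm_extend_inj n l (f : 'I_l -> 'I_n) : injective f ->
  exists (r : nat) (e : (l + r)%N = n) (s : 'S_n),
    forall i, s (cast_ord e (lshift r i)) = f i.
Proof.
(* The indices missed by [f] are enumerated by [g] and fill the last [r] positions. *)
move=> injf; pose C := ~: [set f i | i in 'I_l].
have e : (l + #|C|)%N = n.
  by rewrite -[RHS]card_ord -(cardsC [set f i | i in 'I_l]) card_imset // card_ord.
have [g [injg gC _]] := enum_inj_fun (erefl #|C|).
have inj_h : injective (split_fun f g).
  apply: split_fun_inj => // i j eq_fg.
  by have := gC j; rewrite -eq_fg inE imset_f.
exists #|C|, e; have [s sE] := perm_of_inj_ord e inj_h.
by exists s => i; rewrite sE split_funl.
Qed.

Lemma row_splits_rowsub n l (H : 'M[int]_n) (f : 'I_l -> 'I_n) :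
  injective f -> row_splits H (rowsub f H).
Proof.
move=> injf; have [r [e [s sE]]] := perm_extend_inj injf.
exists s, r, e, (rowsub (fun i => s (cast_ord e (rshift l i))) H).
apply/matrixP => i j; rewrite castmxE cast_ord_id -[in LHS](cast_ordKV e i).
case: (split_ordP (cast_ord (esym e) i)) => k ->.
  by rewrite col_mxEu !mxE sE.
by rewrite col_mxEd !mxE.
Qed.

(** Entries $\pm1$ force the diagonal of the Gram matrix to be $l$, so only its off-diagonal entries
    need a hypothesis. *)
Lemma balancedly_splittable_rowsub n l (a b : int) (H : 'M[int]_n)
    (f : 'I_l -> 'I_n) :
  hadamard H -> injective f -> b <= a ->
  (forall j j', j != j' -> \sum_i H (f i) j * H (f i) j' = a \/
                           \sum_i H (f i) j * H (f i) j' = b) ->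
  balancedly_splittable a b H (rowsub f H).
Proof.
move=> hadH injf le_ba gramH; split => //; first exact: row_splits_rowsub.
pose g j j' := \sum_i H (f i) j * H (f i) j'.
have gramE j j' : ((rowsub f H)^T *m rowsub f H) j j' = g j j'.
  by rewrite mxE; apply: eq_bigr => i _; rewrite !mxE.
(* [A] marks the off-diagonal positions where the Gram entry is [a]. *)
exists (\matrix_(j, j') ((j != j') && (g j j' == a))%:R); split.
  by move=> j j'; rewrite mxE; case: (_ && _); [right | left].
apply/matrixP => j j'; rewrite gramE !mxE.
have [<-{j'} | neq_j] := eqVneq j j' => /=.
  rewrite !mulr0n !mulr1n mulr0 subr0 subrr mulr0 !addr0 /g.
  rewrite (eq_bigr (fun=> 1)) ?sumr_const ?card_ord // => i _.
  by case: (hadH.1 (f i) j) => ->; rewrite ?mulrNN mulr1.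
rewrite !mulr0n add0r subr0; have [-> | neq_ga] := eqVneq (g j j') a.
  by rewrite mulr1 subrr mulr0 addr0.
have [ga | gb] := gramH _ _ neq_j; first by rewrite /g ga eqxx in neq_ga.
by rewrite /g gb mulr0 subr0 mulr1 add0r.
Qed.

(** * Characters of the elementary abelian group of order [4 ^ m] *)

(* [x k = (u_k, v_k)] encodes the pair [(u, v)] of vectors of [F_2 ^ m]. *)
Notation vec m := {ffun 'I_m -> bool * bool}.

Definition chi1 (c a : bool * bool) : int :=
  (-1) ^+ (c.1 && a.1) * (-1) ^+ (c.2 && a.2).

Definition chi m (x y : vec m) : int := \prod_k chi1 (x k) (y k).

(** This is the sign form $(-1)^f$ of $f(u, v) = u \cdot v$. *)
Definition bent m (x : vec m) : int := \prod_k (-1) ^+ ((x k).1 && (x k).2).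

Lemma prod_sign (I : finType) (F : I -> int) :
  (forall i, F i = 1 \/ F i = -1) -> \prod_i F i = 1 \/ \prod_i F i = -1.
Proof.
move=> F1; apply: (big_ind (fun z : int => z = 1 \/ z = -1)) => //; first by left.
by move=> x y [] -> [] ->; rewrite ?mulrNN ?mulr1 ?mul1r; [left | right | right | left].
Qed.

Lemma chi_sign m (x y : vec m) : chi x y = 1 \/ chi x y = -1.
Proof.
apply: prod_sign => k; rewrite /chi1.
by do 2!case: (_ && _); rewrite ?mulrNN ?mulr1 ?mul1r; [left | right | right | left].
Qed.

Lemma bent_sign m (x : vec m) : bent x = 1 \/ bent x = -1.
Proof. by apply: prod_sign => k; case: (_ && _); [right | left]. Qed.

Lemma chiC m (x y : vec m) : chi x y = chi y x.
Proof. by apply: eq_bigr => k _; rewrite /chi1 andbC [_.2 && _]andbC. Qed.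

(** Distributing the product over the sum reduces a character sum on the whole group to sums over
    four elements, one per coordinate. *)
Lemma sum_prod_chi m (phi : bool * bool -> int) (y z : vec m) :
  \sum_(x : vec m) (\prod_k phi (x k)) * (chi x y * chi x z) =
  \prod_k \sum_c phi c * (chi1 c (y k) * chi1 c (z k)).
Proof.
rewrite bigA_distr_bigA; apply: eq_bigr => x _.
by rewrite /chi -!big_split.
Qed.

Lemma sum_bool2 (F : bool * bool -> int) :
  \sum_c F c = F (true, true) + F (true, false)
               + (F (false, true) + F (false, false)).
Proof.
rewrite (eq_bigr (fun c => F (c.1, c.2))) => [|[] //].
by rewrite -(pair_bigA _ (fun a b => F (a, b))) !big_bool.
Qed.

(** The Walsh transform of [bent] at $y + z$ divided by $2^m$; as $u \cdot v$ is self-dual, it is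
    again [bent], taken at $y + z$. *)
Definition bent_dual m (y z : vec m) : int :=
  \prod_k (-1) ^+ (((y k).1 (+) (z k).1) && ((y k).2 (+) (z k).2)).

(** This says that $y + z$ lies in the annihilator of the subgroup $v = 0$. *)
Definition eq_fst m (y z : vec m) : bool := [forall k, (y k).1 == (z k).1].

Lemma sum_bent_chi m (y z : vec m) :
  \sum_x bent x * (chi x y * chi x z) = 2 ^+ m * bent_dual y z.
Proof.
rewrite (sum_prod_chi (fun c => (-1) ^+ (c.1 && c.2))).
have -> : (2 : int) ^+ m = \prod_(k < m) 2 by rewrite prodr_const card_ord.
rewrite -big_split /=.
by apply: eq_bigr => k _; rewrite sum_bool2; case: (y k) (z k) => [[] []] [[] []].
Qed.

Lemma sum_chi m (y z : vec m) :
  \sum_x chi x y * chi x z = 4 ^+ m * (y == z)%:R.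
Proof.
transitivity (\sum_x (\prod_(k < m) 1) * (chi x y * chi x z)).
  by apply: eq_bigr => x _; rewrite big1 // mul1r.
rewrite (sum_prod_chi (fun=> 1)).
have [<-{z} | neq_yz] := eqVneq y z.
  rewrite mulr1 (eq_bigr (fun=> 4)) ?prodr_const ?card_ord // => k _.
  by rewrite sum_bool2; case: (y k) => [[] []].
have /existsP[k neq_k] : [exists k, y k != z k].
  rewrite -negb_forall; apply: contra neq_yz => /forallP eq_yz.
  by apply/eqP/ffunP => k; apply/eqP.
(* The factor at a coordinate where [y] and [z] differ is already 0. *)
rewrite mulr0 (bigD1 k) //= sum_bool2.
by move: neq_k; case: (y k) (z k) => [[] []] [[] []] //= _; rewrite /chi1 /= ?mul0r.
Qed.

(** * The three sets of rows, their character sums and their sizes *)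

Definition line m : {set vec m} := [set x : vec m | [forall k, ~~ (x k).2]].
Definition bent_neg m : {set vec m} := [set x : vec m | bent x == -1].
Definition bent_pos m : {set vec m} := [set x : vec m | bent x == 1] :\: line m.

(** On $v = 0$ the form $u \cdot v$ vanishes. Hence [line m], [bent_neg m] and [bent_pos m]
    partition the group. *)
Lemma bent_line m (x : vec m) : x \in line m -> bent x = 1.
Proof.
rewrite inE => /forallP xl; rewrite /bent big1 // => k _.
by rewrite (negbTE (xl k)) andbF.
Qed.

Lemma line_indicator m (x : vec m) :
  (x \in line m)%:R = \prod_k (~~ (x k).2)%:R :> int.
Proof.
rewrite inE; have [/forallP xl | ] := boolP [forall k, ~~ (x k).2].
  by rewrite big1 // => k _; rewrite xl.
rewrite negb_forall => /existsP[k]; rewrite negbK => xk.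
by rewrite (bigD1 k) //= xk mul0r.
Qed.

Lemma sum_mem (T : finType) (D : {set T}) (F : T -> int) :
  \sum_(x in D) F x = \sum_x (x \in D)%:R * F x.
Proof.
rewrite big_mkcond; apply: eq_bigr => x _.
by case: ifP; rewrite ?mul1r ?mul0r.
Qed.

Lemma sum_line_chi m (y z : vec m) :
  \sum_(x in line m) chi x y * chi x z = 2 ^+ m * (eq_fst y z)%:R.
Proof.
rewrite sum_mem; under eq_bigr => x _ do rewrite line_indicator.
rewrite (sum_prod_chi (fun c => (~~ c.2)%:R)) /eq_fst.
have [/forallP eq_yz | ] := boolP [forall k, (y k).1 == (z k).1].
  rewrite mulr1 (eq_bigr (fun=> 2)) ?prodr_const ?card_ord // => k _.
  by rewrite sum_bool2; move: (eq_yz k); case: (y k) (z k) => [[] []] [[] []].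
rewrite negb_forall => /existsP[k neq_k].
rewrite mulr0 (bigD1 k) //= sum_bool2.
by move: neq_k; case: (y k) (z k) => [[] []] [[] []] //= _; rewrite /chi1 /= ?mul0r.
Qed.

(** Twice the indicator of [bent_neg m] is [1 - bent x]; the factor 2 avoids division in [int]. *)
Lemma sum_bent_neg_chi m (y z : vec m) :
  2 * \sum_(x in bent_neg m) chi x y * chi x z =
  4 ^+ m * (y == z)%:R - 2 ^+ m * bent_dual y z.
Proof.
rewrite sum_mem -sum_chi -sum_bent_chi mulr_sumr -sumrB.
apply: eq_bigr => x _; rewrite inE.
by case: (bent_sign x) => -> /=; ring.
Qed.

(** Twice the indicator of [bent_pos m] is [1 + bent x] minus twice that of [line m], because [bent]
    is 1 on [line m]. *)
Lemma sum_bent_pos_chi m (y z : vec m) :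
  2 * \sum_(x in bent_pos m) chi x y * chi x z =
  4 ^+ m * (y == z)%:R + 2 ^+ m * bent_dual y z
  - 2 * (2 ^+ m * (eq_fst y z)%:R).
Proof.
rewrite -sum_line_chi !sum_mem -sum_chi -sum_bent_chi !mulr_sumr -big_split -sumrB /=.
apply: eq_bigr => x _; rewrite in_setD.
have [/bent_line-> | _] := boolP (x \in line m) => /=; first by ring.
by rewrite inE; case: (bent_sign x) => -> /=; ring.
Qed.

Lemma bent_dual_sign m (y z : vec m) : bent_dual y z = 1 \/ bent_dual y z = -1.
Proof. by apply: prod_sign => k; case: (_ && _); [right | left]. Qed.

(* The annihilator of [line m] lies in the zeros of the dual bent function:
   this keeps the character sums of [bent_pos m] two-valued. *)
Lemma eq_fst_bent_dual m (y z : vec m) : eq_fst y z -> bent_dual y z = 1.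
Proof.
move=> /forallP eq_yz; rewrite /bent_dual big1 // => k _.
by rewrite (eqP (eq_yz k)) addbb.
Qed.

Lemma eq_fst_refl m (y : vec m) : eq_fst y y.
Proof. exact/forallP. Qed.

(** At equal characters every term is 1, so the sizes of the three sets come from the same sum
    formulas. *)
Lemma card_sum_chi m (D : {set vec m}) (y : vec m) :
  #|D|%:R = \sum_(x in D) chi x y * chi x y.
Proof.
rewrite (eq_bigr (fun=> 1)) ?sumr_const // => x _.
by case: (chi_sign x y) => ->; rewrite ?mulrNN mulr1.
Qed.

Lemma card_line m : #|line m| = (2 ^ m)%N.
Proof.
apply/eqP; rewrite -(eqr_nat int) (card_sum_chi _ [ffun=> (false, false)]).
by rewrite sum_line_chi eq_fst_refl mulr1 natrX.
Qed.

Lemma double_half_card n c : (2 * c%:R = (n * n)%:R - n%:R :> int) ->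
  c = (n * (n - 1) %/ 2)%N.
Proof. by move=> cE; have <- : (2 * c = n * (n - 1))%N; [nia | rewrite mulKn]. Qed.

Lemma four_exp m : 4 ^+ m = (2 ^ m * 2 ^ m)%N%:R :> int.
Proof. by rewrite -expnMn natrX. Qed.

Lemma card_bent_neg m : #|bent_neg m| = (2 ^ m * (2 ^ m - 1) %/ 2)%N.
Proof.
apply: double_half_card; rewrite (card_sum_chi _ [ffun=> (false, false)]).
rewrite sum_bent_neg_chi eqxx eq_fst_bent_dual ?eq_fst_refl // !mulr1.
by rewrite four_exp natrX.
Qed.

Lemma card_bent_pos m : #|bent_pos m| = (2 ^ m * (2 ^ m - 1) %/ 2)%N.
Proof.
apply: double_half_card; rewrite (card_sum_chi _ [ffun=> (false, false)]).
rewrite sum_bent_pos_chi eqxx eq_fst_bent_dual ?eq_fst_refl // !mulr1.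
by rewrite four_exp natrX; ring.
Qed.

Lemma line_chi_values m (y z : vec m) :
  \sum_(x in line m) chi x y * chi x z = (2 ^ m)%N%:Z \/
  \sum_(x in line m) chi x y * chi x z = 0.
Proof.
rewrite sum_line_chi; case: eq_fst; rewrite ?mulr1 ?mulr0; last by right.
by left; rewrite -natrX natz.
Qed.

Lemma half_exp2 m : (0 < m)%N -> 2 ^+ m = 2 * (2 ^ m %/ 2)%N%:Z :> int.
Proof.
case: m => // m _; rewrite expnS mulKn // exprS; congr (_ * _).
by rewrite -natrX natz.
Qed.

Lemma bent_neg_chi_values m (y z : vec m) : (0 < m)%N -> y != z ->
  let c := (2 ^ m %/ 2)%N%:Z in
  \sum_(x in bent_neg m) chi x y * chi x z = c \/
  \sum_(x in bent_neg m) chi x y * chi x z = - c.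
Proof.
move=> m_gt0 /negbTE neq_yz c; have := sum_bent_neg_chi y z.
rewrite neq_yz half_exp2 // -/c.
by case: (bent_dual_sign y z) => ->; lia.
Qed.

Lemma bent_pos_chi_values m (y z : vec m) : (0 < m)%N -> y != z ->
  let c := (2 ^ m %/ 2)%N%:Z in
  \sum_(x in bent_pos m) chi x y * chi x z = c \/
  \sum_(x in bent_pos m) chi x y * chi x z = - c.
Proof.
move=> m_gt0 /negbTE neq_yz c; have := sum_bent_pos_chi y z.
rewrite neq_yz half_exp2 // -/c.
(* On the annihilator twice the sum is $2c - 4c$, which gives $-c$; off it the [line m] term
   vanishes. *)
have [/eq_fst_bent_dual-> | _] := boolP (eq_fst y z); first by lia.
by case: (bent_dual_sign y z) => ->; lia.
Qed.

(** * Sylvester matrices as character tables *)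

Definition bit (k i : nat) : bool := odd (i %/ 2 ^ k).

Lemma bitS k i : bit k.+1 i = bit k (i %/ 2).
Proof. by rewrite /bit expnS divnMA. Qed.

Lemma bit0 i : bit 0 i = odd i.
Proof. by rewrite /bit divn1. Qed.

Lemma bit_inj p i j : (i < 2 ^ p)%N -> (j < 2 ^ p)%N ->
  (forall k, (k < p)%N -> bit k i = bit k j) -> i = j.
Proof.
elim: p i j => [|p IHp] i j; first by rewrite expn0; lia.
rewrite expnS => lt_i lt_j eq_bit.
have eq_half : (i %/ 2 = j %/ 2)%N.
  by apply: IHp => [||k lt_k]; rewrite -?bitS ?eq_bit ?ltn_divLR // mulnC.
have := eq_bit 0 isT; rewrite !bit0; lia.
Qed.

Lemma sylvester1E (i j : 'I_2) : sylvester1 i j = (-1) ^+ (odd i && odd j).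
Proof. by rewrite mxE; move: i j; do 2!case=> [[|[|//]]] ?. Qed.

(** The factor [sylvester1] stands on the right of the tensor product, so it reads the lowest bit
    [i %% 2], and the left factor reads [i %/ 2]. *)
Lemma sylvesterE p (i j : 'I_(2 ^ p)) :
  sylvester p i j = \prod_(0 <= k < p) (-1) ^+ (bit k i && bit k j).
Proof.
elim: p i j => [|[|p] IHp] i j.
- by rewrite big_nil mxE (ord1 i) (ord1 j).
- by rewrite big_nat1 !bit0 -sylvester1E.
- rewrite big_nat_recl // !bit0 [sylvester _]/= castmxE mxE IHp sylvester1E mulrC.
  rewrite /= !modn2 !oddb; congr (_ * _).
  by apply: eq_bigr => k _; rewrite !bitS.
Qed.

(** The low [m] bits of the index form $u$, the high [m] bits form $v$. *)
Definition bits m (i : 'I_(2 ^ (2 * m))) : vec m :=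
  [ffun k : 'I_m => (bit k i, bit (m + k) i)].

Lemma bits_inj m : injective (@bits m).
Proof.
move=> i j /ffunP eq_ij; apply/val_inj/(@bit_inj (2 * m)) => [||k lt_k]; try exact: ltn_ord.
have [lt_km | le_mk] := ltnP k m.
  by have := eq_ij (Ordinal lt_km); rewrite !ffunE => -[].
have lt_kBm : (k - m < m)%N by lia.
have := eq_ij (Ordinal lt_kBm); rewrite !ffunE /= => -[_].
by rewrite subnKC.
Qed.

Lemma bits_bij m : bijective (@bits m).
Proof.
apply: inj_card_bij; first exact: bits_inj.
by rewrite card_ffun card_prod card_bool !card_ord expnM.
Qed.

Lemma prod_nat_double (F : nat -> int) m :
  \prod_(0 <= k < 2 * m) F k = \prod_(k < m) (F k * F (m + k)%N).
Proof.
rewrite (big_cat_nat (n := m)) //=; last by lia.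
rewrite -{2}[m]add0n big_addn (_ : 2 * m - m = m)%N; last by lia.
rewrite -big_split big_mkord /=.
by apply: eq_bigr => k _; rewrite [(k + m)%N]addnC.
Qed.

Lemma sylvester_chi m (i j : 'I_(2 ^ (2 * m))) :
  sylvester (2 * m) i j = chi (bits i) (bits j).
Proof.
rewrite sylvesterE prod_nat_double.
by apply: eq_bigr => k _; rewrite !ffunE.
Qed.

(** Orthogonality of characters; permuting the rows only relabels them. *)
Lemma sylvester_hadamard m (s : 'S_(2 ^ (2 * m))) :
  hadamard (row_perm s (sylvester (2 * m))).
Proof.
split=> [i j | ]; first by rewrite mxE sylvester_chi; apply: chi_sign.
apply/matrixP => i j; rewrite !mxE.
transitivity (\sum_x chi x (bits (s i)) * chi x (bits (s j))).
  rewrite (reindex (@bits m)) /=; last exact/onW_bij/bits_bij.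
  by apply: eq_bigr => k _; rewrite !mxE !sylvester_chi ![chi (bits (s _)) _]chiC.
rewrite sum_chi (inj_eq (@bits_inj m)) (inj_eq perm_inj) mulr_natr.
by congr (_ *+ _); rewrite expnM natrX.
Qed.

(* Assembly of the row permutation *)
Local Close Scope ring_scope.

Theorem theorem3p7 (m : nat) (hm : (0 < m)%N) :
  exists s : 'S_(2 ^ (2 * m)),
    twin_balancedly_splittable (2 ^ m) (row_perm s (sylvester (2 * m))).
Proof.
have [dec _ decK] := bits_bij m.
have [h1 [inj1 mem1 sum1]] := enum_inj_fun (card_line m).
have [h2 [inj2 mem2 sum2]] := enum_inj_fun (card_bent_neg m).
have [h3 [inj3 mem3 sum3]] := enum_inj_fun (card_bent_pos m).
set n := (2 ^ m)%N in h1 inj1 mem1 sum1 *.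
set k := (_ %/ 2)%N in h2 inj2 mem2 sum2 h3 inj3 mem3 sum3.
have even_n : ~~ odd n by rewrite /n -(prednK hm) expnS; lia.
have NE : (2 ^ (2 * m) = n ^ 2)%N by rewrite -expnM mulnC.
have e : (n + (k + k) = 2 ^ (2 * m))%N.
  (* Evenness of [n] makes [k] an exact half, and $n + n(n-1) = n^2$. *)
  rewrite NE -mulnn; have : (k + k = n * (n - 1))%N; last by nia.
  by rewrite addnn -muln2 divnK // dvdn2 oddM (negbTE even_n).
(* Disjointness: [bent] separates the second set from the other two, and the third excludes [line m]
   by definition. *)
have inj_h : injective (split_fun h1 (split_fun h2 h3)).
  apply: split_fun_inj => //.
    apply: split_fun_inj => // i j eq_ij.
    by have := mem2 i; have := mem3 j; rewrite -eq_ij !inE => /andP[_ /eqP->].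
  move=> i j; rewrite /split_fun; case: split => {}j eq_ij; have := mem1 i.
    by move=> /bent_line; have := mem2 j; rewrite -eq_ij inE => /eqP->.
  by have := mem3 j; rewrite -eq_ij in_setD => /andP[/negbTE->].
have [s sE] := perm_of_inj_ord e (inj_comp (can_inj decK) inj_h).
exists s; split=> //.
set H := row_perm _ _.
pose f1 (i : 'I_n) := cast_ord e (lshift (k + k) i).
pose f2 (i : 'I_k) := cast_ord e (rshift n (lshift k i)).
pose f3 (i : 'I_k) := cast_ord e (rshift n (rshift k i)).
exists (rowsub f1 H), (rowsub f2 H), (rowsub f3 H), e.
(* A Gram entry of selected rows is a character sum over the set [D] that [h] enumerates. *)
have gramE l (h : 'I_l -> vec m) (f : 'I_l -> 'I_(2 ^ (2 * m))) (D : {set vec m}) :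
    (forall F : vec m -> int, \sum_i F (h i) = \sum_(x in D) F x)%R ->
    (forall i, s (f i) = dec (h i)) ->
    forall j j', (\sum_i H (f i) j * H (f i) j' =
                  \sum_(x in D) chi x (bits j) * chi x (bits j'))%R.
  move=> sumh sf j j'; rewrite -sumh; apply: eq_bigr => i _.
  by rewrite !mxE !sylvester_chi sf decK.
split.
- apply/matrixP => i j; rewrite castmxE cast_ord_id -[in LHS](cast_ordKV e i).
  case: (split_ordP (cast_ord (esym e) i)) => {}i ->; first by rewrite col_mxEu !mxE.
  by rewrite col_mxEd; case: (split_ordP i) => {}i ->;
    rewrite ?col_mxEu ?col_mxEd !mxE.
- apply: balancedly_splittable_rowsub => //; first exact: sylvester_hadamard.
    by move=> i i' /cast_ord_inj/lshift_inj.
  move=> j j' _; rewrite (gramE _ _ _ _ sum1); first exact: line_chi_values.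
  by move=> i; rewrite sE /= split_funl.
- apply: balancedly_splittable_rowsub; first exact: sylvester_hadamard.
  + by move=> i i' /cast_ord_inj/rshift_inj/lshift_inj.
  + by lia.
  move=> j j' neq_j; rewrite (gramE _ _ _ _ sum2).
    by apply: bent_neg_chi_values; rewrite ?(inj_eq (@bits_inj m)).
  by move=> i; rewrite sE /= split_funr split_funl.
- apply: balancedly_splittable_rowsub; first exact: sylvester_hadamard.
  + by move=> i i' /cast_ord_inj/rshift_inj/rshift_inj.
  + by lia.
  move=> j j' neq_j; rewrite (gramE _ _ _ _ sum3).
    by apply: bent_pos_chi_values; rewrite ?(inj_eq (@bits_inj m)).
  by move=> i; rewrite sE /= !split_funr.
Qed.
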